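(* Let $X\subset\mathbb{R}^n$ be an orthosymmetric convex body. For any sequence of symmetric positive definite matrices $A(k)\in\mathbb{R}^{n\times n}$, $k=1,2,\dots$, there exist vectors $g_i=g_i(k)\in\mathbb{R}^n$, $i=1,\dots,k$, with $\|g_i\|_\infty\le1$, such that the regret of the Euclidean method with matrix $A(k)$ on the linear functions $x\mapsto g_i(k)^\top x$, $i=1,\dots,k$, satisfies $$\liminf_{k\to\infty}\frac1{\sqrt k}\sup_{x\in X}\mathrm{Regret}_{k,A(k)}(x)\ \ge\ \sup_{x\in\mathrm{QHull}(X)}\|x\|_1.$$ Additionally, for each $k$ there exists a diagonal positive definite matrix $D$ such that for any sequence of convex functions $F_1,\dots,F_k:\mathbb{R}^n\to\mathbb{R}$ all of whose subgradients $g$ satisfy $\|g\|_\infty\le1$, $$\sup_{x\in X}\mathrm{Regret}_{k,D}(x)\ \le\ \sqrt k\ \sup_{x\in\mathrm{QHull}(X)}\|x\|_1.$$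
   Context: A convex body is a compact convex set with nonempty interior. A set $C\subset\mathbb{R}^n$ is orthosymmetric if $x\in C$ and $\sigma\in\{\pm1\}^n$ imply $(\sigma_jx_j)_j\in C$. With $C^2=\{(x_j^2)_j:x\in C\}$, the quadratic hull of $C$ is $\mathrm{QHull}(C)=\{(s_j\sqrt{v_j})_j:v\in\mathrm{Conv}(C^2),\ s\in\{\pm1\}^n\}$, which for orthosymmetric convex $C$ is the smallest convex set $Q\supset C$ with $Q^2$ convex. For positive definite $A$ and convex $F_1,\dots,F_k$, the Euclidean method (online mirror descent with $h_A(x)=\frac12x^\top Ax$, unconstrained, started at $0$) plays $x_1=0$ and $x_i=-A^{-1}\sum_{l<i}g_l$ with $g_l\in\partial F_l(x_l)$, and $\mathrm{Regret}_{k,A}(x)=\sum_{i=1}^k[F_i(x_i)-F_i(x)]$. For linear functions $F_i(x)=g_i^\top x$ this is $\sum_{i=1}^kg_i^\top(x_i-x)$. *)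

(* Defs.v *)
From HB Require Import structures.
From mathcomp Require Import all_boot all_order all_algebra.
From mathcomp Require Import all_classical all_reals all_analysis.
Set Implicit Arguments.
Unset Strict Implicit.
Unset Printing Implicit Defensive.
Import Order.TTheory GRing.Theory Num.Theory.
Import numFieldNormedType.Exports.
Local Open Scope classical_set_scope.
Local Open Scope ring_scope.

Section Geometry.
Context {R : realType} {n : nat}.
Implicit Types (C : set 'cV[R]_n) (x y g : 'cV[R]_n).

Definition convex_body C :=
  [/\ compact C, convex_set C & interior C !=set0].

(* A sign vector is encoded by its set of minus signs s : 'I_n -> bool. *)
Definition flip_signs (s : 'I_n -> bool) x : 'cV[R]_n :=
  \col_j ((-1) ^+ s j * x j 0).

Definition orthosymmetric C := forall x s, C x -> C (flip_signs s x).

Definition set_sqr C : set 'cV[R]_n :=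
  [set map_mx (fun t => t ^+ 2) x | x in C].

Definition conv_hull C : set 'cV[R]_n :=
  smallest (@convex_set R 'cV[R]_n) C.

Definition QHull C : set 'cV[R]_n :=
  [set x | exists v s, conv_hull (set_sqr C) v /\
                       x = flip_signs s (map_mx Num.sqrt v)].

Definition l1norm x : R := \sum_j `|x j 0|.

Definition dotv g x : R := (g^T *m x) 0 0.

Definition posdefmx (A : 'M[R]_n) :=
  A^T = A /\ forall x, x != 0 -> 0 < dotv x (A *m x).

Definition subgradient (f : 'cV[R]_n -> R) x g :=
  forall y, f x + dotv g (y - x) <= f y.

End Geometry.

Section EuclideanMethod.
Context {R : realType} {n k : nat}.
Implicit Types (A : 'M[R]_n) (F : 'I_k -> 'cV[R]_n -> R).
Implicit Types (g : 'I_k -> 'cV[R]_n).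

(* Rounds are numbered from 0, so that the iterate of index 0 is 0. *)
Definition euclidean_iterate A g (i : 'I_k) : 'cV[R]_n :=
  - (invmx A *m \sum_(l < k | (l < i)%N) g l).

(* The subgradients need not be unique: g records the ones returned to the
   method along the run. *)
Definition euclidean_run A F g :=
  forall i, subgradient (F i) (euclidean_iterate A g i) (g i).

Definition regret A F g (x : 'cV[R]_n) : R :=
  \sum_(i < k) (F i (euclidean_iterate A g i) - F i x).

End EuclideanMethod.

(* On linear losses the run exists and is unique. *)
Lemma subgradient_dotv (R : realType) (n : nat) (g x h : 'cV[R]_n) :
  subgradient (dotv g) x h <-> h = g.
Proof.
have dotvB (u v w : 'cV[R]_n) : dotv u (v - w) = dotv u v - dotv u w.
  by rewrite /dotv mulmxBr !mxE.
split=> [sub|-> y]; last by rewrite dotvB addrC subrK.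
have le0 d : dotv (h - g) d <= 0.
  have := sub (x + d); rewrite [x + d - x]addrAC subrr add0r.
  have -> : dotv g (x + d) = dotv g x + dotv g d by rewrite /dotv mulmxDr mxE.
  have -> : dotv (h - g) d = dotv h d - dotv g d.
    by rewrite /dotv linearB /= mulmxBl !mxE.
  by rewrite lerD2l subr_le0.
apply/subr0_eq/matrixP => j i; rewrite ord1 [RHS]mxE.
have := le0 (h - g); rewrite /dotv mxE => sum_le0.
have sum0 : \sum_l (h - g)^T 0 l * (h - g) l 0 = 0.
  apply/eqP; rewrite eq_le sum_le0 sumr_ge0// => l _.
  by rewrite [_^T _ _]mxE -expr2 sqr_ge0.
have ge0 (l : 'I_n) : true -> 0 <= (h - g)^T 0 l * (h - g) l 0.
  by rewrite [_^T _ _]mxE -expr2 sqr_ge0.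
have /eqP := psumr_eq0P ge0 sum0 (i := j) isT.
by rewrite [_^T _ _]mxE -expr2 sqrf_eq0 => /eqP.
Qed.

Lemma euclidean_run_linear (R : realType) (n k : nat) (A : 'M[R]_n)
    (g h : 'I_k -> 'cV[R]_n) :
  euclidean_run A (fun i => dotv (g i)) h <-> h = g.
Proof.
split=> [run|-> i]; last by apply/subgradient_dotv.
by apply/funext => i; have /subgradient_dotv := run i.
Qed.

(* Main.v *)
Require Import Defs.
From HB Require Import structures.
From mathcomp Require Import all_boot all_order all_algebra.
From mathcomp Require Import all_classical all_reals all_analysis.
From mathcomp Require Import ring lra.
Import Order.TTheory GRing.Theory Num.Theory.
Import numFieldNormedType.Exports.
Local Open Scope classical_set_scope.
Local Open Scope ring_scope.
Set Implicit Arguments.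
Unset Strict Implicit.
Unset Printing Implicit Defensive.

(** Write [q_A x] for [dotv x (A *m x)], [B] for the inverse of [A] and [G] for
    the sum of the losses [g i]. On linear losses the regret against [x] is
    [- dotv G x - q_B G / 2 + (\sum_i q_B (g i)) / 2] ([regret_dotv]), and the
    first two terms are at most [q_A x / 2] ([posdef_young]). So everything
    turns on the game with value [(q_A x + \sum_i q_B (g i)) / 2]. The supremum
    of [\sum_j Num.sqrt (v j 0)] over the convex hull of the squares of [X] is
    that of the l1 norm over the quadratic hull ([l1norm_QHull]); call it [S].

    Upper bound. Subgradients reduce convex losses to linear ones. Let [v] be a
    maximizer of the sum of square roots over the closure of the hull, and
    [a j] the square root of [v j 0]. Its first-order condition is
    [\sum_j x j 0 ^+ 2 / a j <= \sum_j a j] on [X], and [\sum_j a j <= S]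
    ([sqrt_sum_supporting]). The diagonal matrix with entries
    [Num.sqrt k / a j] then makes both halves of the game at most
    [Num.sqrt k * S / 2] ([regret_diag_le]).

    Lower bound. Both halves can almost be attained together. Alternating
    between [u] and [- u], for a sign vector [u] with [q_B u >= \tr B], collects
    [q_B u] in every round without moving [G]; a few more rounds then
    bring [G] to [- A x], where Young's inequality is an equality
    ([regret_oscillate_drift]). Here [x] is a point of [X] with
    [q_A x >= \sum_j A j j * x j 0 ^+ 2], the right-hand side being maximal over
    [X], hence over the hull of squares. Both sign patterns come from
    [exists_signs_diag_le]. As [\tr B >= \sum_j (A j j)^-1], the
    arithmetic-geometric mean inequality gives a regret of at least
    [Num.sqrt k' * \sum_j Num.sqrt (v j 0)] for every [v] in the hull, with [k']
    the number of alternating rounds. If [\tr A] is of order [Num.sqrt k] at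
    most, the drift costs only [O(Num.sqrt k)] rounds. If it is larger, drifting
    to a fraction [t] of [- A x] is as cheap and already yields a regret of at
    least [Num.sqrt k * S] ([exists_losses_regret_ge]). *)

(** * Linear algebra of the inner product *)

Section Dotv.
Context {R : realType} {n : nat}.
Implicit Types (x y z : 'cV[R]_n) (A : 'M[R]_n).

Lemma dotvE x y : dotv x y = \sum_j x j 0 * y j 0.
Proof. by rewrite /dotv mxE; apply: eq_bigr => j _; rewrite mxE. Qed.

Lemma dotvC x y : dotv x y = dotv y x.
Proof. by rewrite !dotvE; apply: eq_bigr => j _; rewrite mulrC. Qed.

Lemma dotvDr x y z : dotv x (y + z) = dotv x y + dotv x z.
Proof. by rewrite /dotv mulmxDr mxE. Qed.

Lemma dotvZr a x y : dotv x (a *: y) = a * dotv x y.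
Proof. by rewrite /dotv -scalemxAr mxE. Qed.

Lemma dotvNr x y : dotv x (- y) = - dotv x y.
Proof. by rewrite -scaleN1r dotvZr mulN1r. Qed.

Lemma dotvBr x y z : dotv x (y - z) = dotv x y - dotv x z.
Proof. by rewrite dotvDr dotvNr. Qed.

Lemma dotvDl x y z : dotv (y + z) x = dotv y x + dotv z x.
Proof. by rewrite dotvC dotvDr !(dotvC x). Qed.

Lemma dotvZl a x y : dotv (a *: y) x = a * dotv y x.
Proof. by rewrite dotvC dotvZr dotvC. Qed.

Lemma dotvNl x y : dotv (- y) x = - dotv y x.
Proof. by rewrite dotvC dotvNr dotvC. Qed.

Lemma dotv_sumr I (r : seq I) (P : pred I) x (f : I -> 'cV[R]_n) :
  dotv x (\sum_(i <- r | P i) f i) = \sum_(i <- r | P i) dotv x (f i).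
Proof. by rewrite /dotv mulmx_sumr summxE. Qed.

Lemma dotv_suml I (r : seq I) (P : pred I) x (f : I -> 'cV[R]_n) :
  dotv (\sum_(i <- r | P i) f i) x = \sum_(i <- r | P i) dotv (f i) x.
Proof. by rewrite dotvC dotv_sumr; apply: eq_bigr => i _; rewrite dotvC. Qed.

Lemma dotv_symmx A x y : A^T = A -> dotv x (A *m y) = dotv y (A *m x).
Proof. by move=> symA; rewrite dotvC /dotv trmx_mul symA -mulmxA. Qed.

Lemma dotv_delta x j : dotv (delta_mx j 0) x = x j 0.
Proof.
rewrite dotvE (bigD1 j)//= big1 => [|i ij]; rewrite mxE ?eqxx ?mul1r ?addr0//.
by rewrite (negbTE ij) mul0r.
Qed.

Lemma dotv_deltamx A i j : dotv (delta_mx i 0) (A *m delta_mx j 0) = A i j.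
Proof. by rewrite dotv_delta -colE mxE. Qed.

Lemma normcV_le c x : 0 <= c -> (forall j, `|x j 0| <= c) -> `|x| <= c.
Proof.
move=> c0 xc; rewrite /Num.Def.normr/= mx_normrE.
by apply: bigmax_le => // -[i j] _; rewrite ord1 xc.
Qed.

Lemma le_normcV x j : `|x j 0| <= `|x|.
Proof.
rewrite [leRHS]/Num.Def.normr/= mx_normrE.
exact: (le_bigmax _ (fun ij : 'I_n * 'I_1 => `|x ij.1 ij.2|) (j, 0)).
Qed.

End Dotv.

(** * Regret on linear losses *)

Section Regret.
Context {R : realType} {n k : nat}.
Implicit Types (A : 'M[R]_n) (g : 'I_k -> 'cV[R]_n) (x : 'cV[R]_n).

Lemma dotv_sqr_sum A g : A^T = A ->
  dotv (\sum_i g i) (A *m \sum_i g i) =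
  \sum_i dotv (g i) (A *m g i) +
  2 * \sum_i dotv (g i) (A *m \sum_(l < k | (l < i)%N) g l).
Proof.
move=> symA; rewrite dotv_suml.
pose b i l := dotv (g i) (A *m g l).
have row i : dotv (g i) (A *m \sum_i g i) =
    b i i + \sum_(l < k | (l < i)%N) b i l + \sum_(l < k | (i < l)%N) b i l.
  rewrite mulmx_sumr dotv_sumr (bigD1 i)//= -addrA; congr (_ + _).
  rewrite (bigID (fun l : 'I_k => (l < i)%N))/=; congr (_ + _);
    apply: eq_bigl => l; rewrite -(inj_eq val_inj)/=.
    by rewrite andbC; case: ltngtP.
  by case: ltngtP.
under eq_bigr do rewrite row.
rewrite !big_split/= -addrA; congr (_ + _).
rewrite [X in _ + X](exchange_big_dep xpredT)//=.
rewrite mulr_sumr -big_split/=; apply: eq_bigr => i _.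
rewrite mulmx_sumr dotv_sumr mulr_natl mulr2n; congr (_ + _).
by apply: eq_bigr => l _; rewrite /b dotv_symmx.
Qed.

(** The iterates contribute the cross terms of the square of the sum of the
    losses. Since the right-hand side depends on the losses only through their
    sum and their individual dual forms, losses that cancel in pairs still raise
    the regret. *)
Lemma regret_dotv A g x : (invmx A)^T = invmx A ->
  regret A (fun i => dotv (g i)) g x =
  - dotv (\sum_i g i) x
  - 2^-1 * dotv (\sum_i g i) (invmx A *m \sum_i g i)
  + 2^-1 * \sum_i dotv (g i) (invmx A *m g i).
Proof.
move=> symB; rewrite (dotv_sqr_sum _ symB) /regret /euclidean_iterate.
rewrite sumrB -dotv_suml.
under eq_bigr do rewrite dotvNr.
rewrite sumrN; lra.
Qed.

Lemma regret_le_dotv A (F : 'I_k -> 'cV[R]_n -> R) g x : euclidean_run A F g ->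
  regret A F g x <= regret A (fun i => dotv (g i)) g x.
Proof.
move=> run; apply: ler_sum => i _.
have := run i x; rewrite dotvBr; lra.
Qed.

End Regret.

(** * Positive definite quadratic forms *)

Section Posdef.
Context {R : realType} {n : nat}.
Implicit Types (A : 'M[R]_n) (x y g : 'cV[R]_n).

Lemma posdef_ge0 A x : posdefmx A -> 0 <= dotv x (A *m x).
Proof.
case=> _ posA; have [->|/posA/ltW//] := eqVneq x 0.
by rewrite mulmx0 /dotv mulmx0 mxE.
Qed.

Lemma posdef_unitmx A : posdefmx A -> A \in unitmx.
Proof.
case=> symA posA; rewrite unitmxE unitfE; apply/det0P => -[v v0 vA].
have := posA v^T; rewrite trmx_eq0 v0 => /(_ isT).
by rewrite -symA -trmx_mul vA trmx0 /dotv mulmx0 mxE ltxx.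
Qed.

Lemma posdef_inv_sym A : posdefmx A -> (invmx A)^T = invmx A.
Proof. by case=> symA _; rewrite trmx_inv symA. Qed.

Lemma posdef_inv_ge0 A g : posdefmx A -> 0 <= dotv g (invmx A *m g).
Proof.
move=> pA; rewrite -{1}(mulKVmx (posdef_unitmx pA) g) dotvC; exact: posdef_ge0.
Qed.

Lemma posdef_diag_gt0 A j : posdefmx A -> 0 < A j j.
Proof.
case=> _ posA; rewrite -dotv_deltamx; apply: posA.
by apply/eqP => /matrixP/(_ j 0)/eqP; rewrite !mxE !eqxx oner_eq0.
Qed.

(** Young's inequality for a quadratic form and its dual: the form is
    nonnegative at [x + invmx A *m g]. *)
Lemma posdef_young A x g : posdefmx A ->
  - dotv g x - 2^-1 * dotv g (invmx A *m g) <= 2^-1 * dotv x (A *m x).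
Proof.
move=> pA; have := posdef_ge0 (x + invmx A *m g) pA.
rewrite mulmxDr mulKVmx ?posdef_unitmx// !(dotvDl, dotvDr).
rewrite (dotv_symmx (invmx A *m g) x pA.1) mulKVmx ?posdef_unitmx//.
rewrite (dotvC x g) (dotvC _ g); lra.
Qed.

(** The form is nonnegative at the sum and at the difference of the basis
    vectors [i] and [j]. *)
Lemma posdef_entry_le A i j : posdefmx A -> `|A i j| <= \tr A.
Proof.
move=> pA; have diag_ge0 l : 0 <= A l l by rewrite ltW// posdef_diag_gt0.
have trA l : A l l <= \tr A.
  by rewrite /mxtrace (bigD1 l)//= lerDl sumr_ge0.
have Aji : A j i = A i j by rewrite -{1}pA.1 mxE.
have := posdef_ge0 (delta_mx i 0 + delta_mx j 0) pA.
have := posdef_ge0 (delta_mx i 0 - delta_mx j 0) pA.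
rewrite !(mulmxDr, mulmxN) !(dotvDl, dotvDr, dotvNl, dotvNr) !dotv_deltamx Aji.
have := trA i; have := trA j; rewrite ler_norml; lra.
Qed.

(** Young's inequality at the [j]-th basis vector, against the best multiple of
    that vector. *)
Lemma posdef_inv_diag A j : posdefmx A -> (A j j)^-1 <= invmx A j j.
Proof.
move=> pA; have a0 := posdef_diag_gt0 j pA.
have := posdef_young ((- (A j j)^-1) *: delta_mx j 0) (delta_mx j 0) pA.
rewrite -scalemxAr !(dotvZl, dotvZr) !dotv_deltamx dotv_delta mxE !eqxx/=.
have -> : - (A j j)^-1 * (- (A j j)^-1 * A j j) = (A j j)^-1.
  by field; rewrite gt_eqF.
lra.
Qed.

(** At a sign pattern maximizing the form, flipping one more sign does not
    increase it; adding up these [n] inequalities gives the bound. *)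
Lemma exists_signs_diag_le A x : A^T = A ->
  exists s, \sum_j A j j * x j 0 ^+ 2 <=
            dotv (flip_signs s x) (A *m flip_signs s x).
Proof.
move=> symA.
pose q (s : {ffun 'I_n -> bool}) :=
  dotv (flip_signs s x) (A *m flip_signs s x).
have [s _ smax] := @arg_maxP _ _ _ [ffun=> false] xpredT q isT.
exists s; rewrite [leRHS]dotvE; apply: ler_sum => j _.
set y := flip_signs s x.
have yj2 : x j 0 ^+ 2 = y j 0 ^+ 2 by rewrite mxE exprMn sqrr_sign mul1r.
pose s' := [ffun i => s i (+) (i == j)].
have ys' : flip_signs s' x = y - (2 * y j 0) *: delta_mx j 0.
  apply/matrixP => i c; rewrite ord1 !mxE ffunE eqxx andbT.
  have [->|_] := eqVneq i j; rewrite ?addbT ?addbF ?signrN.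
    by rewrite mulr1n; ring.
  by rewrite mulr0n; ring.
have := smax s' isT; rewrite /q ys' -/y.
rewrite mulmxBr -scalemxAr !(dotvBr, dotvDl, dotvNl, dotvZl, dotvZr).
rewrite (dotv_symmx y (delta_mx j 0) symA) !dotv_deltamx !dotv_delta yj2 /=.
by set z := (A *m y) j 0; rewrite !expr2; lra.
Qed.

End Posdef.

(** * Hull of squares, and compactness *)

Section Geometry.
Context {R : realType} {n : nat}.
Implicit Types (C K X : set 'cV[R]_n) (x y v : 'cV[R]_n).

Lemma convex_setP K : convex_set K <->
  forall x y (t : R), 0 <= t <= 1 -> K x -> K y -> K (t *: x + (1 - t) *: y).
Proof.
split=> [cK x y t /andP[t0 t1] Kx Ky|cK x y t /set_mem Kx /set_mem Ky].
  by have /set_mem := cK x y (Itv01 t0 t1) (mem_set Kx) (mem_set Ky).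
by apply/mem_set/cK => //; rewrite ge0 le1.
Qed.

Lemma conv_hull_convex C : convex_set (conv_hull C).
Proof.
apply/convex_setP => x y t t01 hx hy K [cK CK].
by move/convex_setP : (cK); apply=> //; [exact: hx|exact: hy].
Qed.

Lemma sub_conv_hull C : C `<=` conv_hull C.
Proof. by move=> x Cx K [_]; exact. Qed.

Lemma conv_hull_sub C K : convex_set K -> C `<=` K -> conv_hull C `<=` K.
Proof. by move=> cK CK x; apply. Qed.

Lemma conv_hull_sqr_le X (a : 'I_n -> R) h :
  (forall x, X x -> \sum_j a j * x j 0 ^+ 2 <= h) ->
  forall v, conv_hull (set_sqr X) v -> \sum_j a j * v j 0 <= h.
Proof.
move=> Xh; apply: (@conv_hull_sub _ [set v | \sum_j a j * v j 0 <= h]).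
  apply/convex_setP => x y t /andP[t0 t1] /= xh yh.
  rewrite (_ : \sum_j _ = t * (\sum_j a j * x j 0) +
                          (1 - t) * (\sum_j a j * y j 0)); first nra.
  by rewrite !mulr_sumr -big_split/=; apply: eq_bigr => j _; rewrite !mxE; ring.
move=> _ [x Xx <-]/=; apply: le_trans (Xh _ Xx).
by apply: ler_sum => j _; rewrite mxE.
Qed.

Lemma conv_hull_sqr_coord X M : (forall x, X x -> forall j, `|x j 0| <= M) ->
  forall v, conv_hull (set_sqr X) v -> forall j, 0 <= v j 0 <= M ^+ 2.
Proof.
move=> XM.
apply: (@conv_hull_sub _ [set v | forall j, 0 <= v j 0 <= M ^+ 2]).
  apply/convex_setP => x y t /andP[t0 t1] /= xh yh j; rewrite !mxE.
  have := xh j; have := yh j; nra.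
move=> _ [x Xx <-] j; rewrite mxE sqr_ge0 -real_normK ?num_real//=.
by rewrite ler_sqr ?nnegrE ?XM// (le_trans _ (XM _ Xx j)).
Qed.

Lemma l1norm_QHull X : [set l1norm x | x in QHull X] =
  [set \sum_j Num.sqrt (v j 0) | v in conv_hull (set_sqr X)].
Proof.
have l1 s v : l1norm (flip_signs s (map_mx Num.sqrt v)) =
              \sum_j Num.sqrt (v j 0).
  apply: eq_bigr => j _; rewrite !mxE normrM normrX normrN1 expr1n mul1r.
  by rewrite ger0_norm ?sqrtr_ge0.
apply/seteqP; split=> [_ [_ [v [s [hv ->]]] <-]|_ [v hv <-]].
  by exists v.
exists (flip_signs (fun=> false) (map_mx Num.sqrt v)) => //.
by exists v, (fun=> false).
Qed.

Lemma compact_coord_bounded X : compact X ->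
  exists2 M, 0 <= M & forall x, X x -> forall j, `|x j 0| <= M.
Proof.
move=> /compact_bounded/pinfty_ex_gt0[M M0 XM].
exists M => [|x /XM xM j]; first exact: ltW.
exact: le_trans (le_normcV x j) xM.
Qed.

(** Around an interior point, each coordinate can be pushed away from zero,
    independently of the others. *)
Lemma interior_coord_ge X : interior X !=set0 ->
  exists2 e, 0 < e & exists2 x, X x & forall j, e <= `|x j 0|.
Proof.
move=> [x /nbhs_ballP[r /= r0 rX]]; exists (r / 2); first by rewrite divr_gt0.
exists (x + \col_j (if 0 <= x j 0 then r / 2 else - (r / 2))) => [|j].
  apply: rX; rewrite -ball_normE/= opprD addrA subrr add0r normrN.
  apply: le_lt_trans (_ : r / 2 < r); last by lra.
  have r20 : 0 <= r / 2 by lra.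
  by apply: normcV_le => // j; rewrite mxE; case: ifP; rewrite ?normrN ger0_norm.
rewrite !mxE; case: ifPn => [xj0|]; first by rewrite ger0_norm; lra.
by rewrite -ltNge => xj0; rewrite ltr0_norm; lra.
Qed.

Lemma continuous_sum_coord (f : 'I_n -> R -> R) :
  (forall j, continuous (f j)) ->
  continuous (fun x : 'cV[R]_n => \sum_j f j (x j 0)).
Proof.
move=> cf; apply: continuous_big => [|j _]; first exact: add_continuous.
by move=> x; apply: continuous_comp; [exact: coord_continuous|exact: cf].
Qed.

(** Transposition carries over the compactness criterion for row vectors. *)
Lemma bounded_closed_compact_cV K M :
  (forall x, K x -> forall j, `|x j 0| <= M) -> closed K -> compact K.
Proof.
move=> KM clK.
have ctr (m p : nat) : continuous (@trmx R m p).
  move=> x A /nbhs_ballP[e e0 eA]; apply/nbhs_ballP; exists e => //= y [_ xy].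
  by apply: eA; split=> // i j; rewrite !mxE.
have -> : K = trmx @` (trmx @^-1` K : set 'rV[R]_n).
  apply/seteqP; split=> [x Kx|_ [y Ky <-]//].
  by exists x^T; rewrite /= ?trmxK.
apply: continuous_compact; first exact/continuous_subspaceT/ctr.
apply: bounded_closed_compact.
  exists `|M|; split=> [|c Mc y Ky]; first exact: num_real.
  rewrite /Num.Def.normr/= mx_normrE; apply: bigmax_le => [|[i j] _].
    by rewrite ltW// (le_lt_trans _ Mc).
  have := KM _ Ky j; rewrite mxE /= ord1 => /le_trans; apply.
  exact: le_trans (ler_norm M) (ltW Mc).
by apply: closed_comp => // x _; exact: ctr.
Qed.

End Geometry.

(** * Maximizing a sum of square roots *)

Section SqrtSum.
Context {R : realType} {n : nat}.
Implicit Types (K : set 'cV[R]_n) (v w : 'cV[R]_n).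

Lemma ler_sqrt_of_sqr (a x : R) : a ^+ 2 <= x -> a <= Num.sqrt x.
Proof.
move=> ax; apply: le_trans (ler_norm a) _; rewrite -sqrtr_sqr.
by rewrite ler_wsqrtr.
Qed.

(** A second-order Taylor bound valid up to the end point where the root
    vanishes: with [s ^+ 2 = a ^+ 2 + u], the gap is a positive multiple of
    [(s - a) ^+ 2 * (s * (s + 2 * a))]. *)
Lemma sqrt_ge_quadratic (a u : R) : 0 < a -> 0 <= a ^+ 2 + u ->
  a + u * (2 * a)^-1 - u ^+ 2 * (2 * a ^+ 3)^-1 <= Num.sqrt (a ^+ 2 + u).
Proof.
move=> a0 au0; set s := Num.sqrt _.
have s0 : 0 <= s by rewrite sqrtr_ge0.
have uE : u = s ^+ 2 - a ^+ 2 by rewrite sqr_sqrtr//; ring.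
rewrite -subr_ge0.
rewrite (_ : _ - _ =
    (s - a) ^+ 2 * (s * (s + 2 * a)) * (2 * a ^+ 3)^-1); last first.
  by rewrite uE; field; rewrite gt_eqF.
apply: mulr_ge0; last by rewrite invr_ge0 mulr_ge0// exprn_ge0// ltW.
by rewrite mulr_ge0 ?sqr_ge0// mulr_ge0// addr_ge0// mulr_ge0// ltW.
Qed.

Lemma closure_segment K v w (t : R) : convex_set K -> 0 <= t <= 1 ->
  closure K v -> K w -> closure K (t *: w + (1 - t) *: v).
Proof.
move=> /convex_setP cK t01 clv Kw B /nbhs_ballP[e /= e0 eB].
have [y [Ky]] := clv _ (nbhsx_ballx v e e0).
rewrite -ball_normE /= => vy; exists (t *: w + (1 - t) *: y).
split; first exact: cK.
apply: eB; rewrite -ball_normE /= opprD addrACA subrr add0r -scalerBr normrZ.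
have /andP[t0 t1] := t01.
apply: le_lt_trans vy; rewrite ger0_norm ?subr_ge0//.
by rewrite ler_piMl// lerBlDr lerDl.
Qed.

(** [a] lists the square roots of the coordinates of a maximizer of
    [v |-> \sum_j Num.sqrt (v j 0)] over the closure of [K]. Since the square
    root has infinite slope at [0] and [w] has positive coordinates, so has the
    maximizer, and the maximization has a first-order condition: the third
    property. Passing to the closure makes the maximum exist, and does not raise
    the bound [S] because the sum is continuous. *)
Lemma sqrt_sum_supporting K M w : convex_set K ->
  (forall v, K v -> forall j, 0 <= v j 0 <= M) ->
  K w -> (forall j, 0 < w j 0) ->
  exists a : 'I_n -> R, [/\ forall j, 0 < a j,
    forall S, (forall v, K v -> \sum_j Num.sqrt (v j 0) <= S) ->
      \sum_j a j <= S
    & forall v, K v -> \sum_j v j 0 / a j <= \sum_j a j].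
Proof.
move=> cK K0M Kw w0; pose f (v : 'cV[R]_n) := \sum_j Num.sqrt (v j 0).
have cf : continuous f.
  apply: (@continuous_sum_coord R n (fun=> Num.sqrt)) => j.
  exact: sqrt_continuous.
have clK0M v : closure K v -> forall j, 0 <= v j 0 <= M.
  move=> clv j; have : closed [set v : 'cV[R]_n | v j 0 \in `[0, M]].
    apply: (@closed_comp _ _ (fun v : 'cV[R]_n => v j 0) `[0, M]%classic).
      by move=> x _; exact: coord_continuous.
    exact: itv_closed.
  move=> /closure_id clE.
  have : closure [set v : 'cV[R]_n | v j 0 \in `[0, M]] v.
    by apply: closure_subset clv => y Ky; rewrite /= in_itv/= K0M.
  by rewrite -clE /= in_itv.
have compK : compact (closure K).
  apply: (@bounded_closed_compact_cV _ _ _ M); last exact: closed_closure.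
  by move=> v /clK0M vM j; have /andP[v0 ?] := vM j; rewrite ger0_norm.
have [v /set_mem clv vmax] := compact_EVT_max
  (ex_intro _ w (subset_closure Kw)) compK (continuous_subspaceT cf).
have {}vmax u t : K u -> 0 <= t <= 1 ->
    \sum_j Num.sqrt (v j 0 + t * (u j 0 - v j 0)) <= f v.
  move=> Ku t01; have := vmax _ (mem_set (closure_segment cK t01 clv Ku)).
  apply: le_trans; rewrite le_eqVlt; apply/orP; left; apply/eqP.
  by apply: eq_bigr => j _; rewrite !mxE; congr Num.sqrt; ring.
have v0 j : 0 <= v j 0 by have /andP[] := clK0M _ clv j.
have vpos j : 0 < v j 0.
  rewrite lt_neqAle v0 andbT eq_sym; apply/negP => /eqP vj0.
  (* Moving from [v] towards [w] by a fraction [s ^+ 2] gains [s * b] at [j] and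
     loses at most [s ^+ 2 * f v] elsewhere, so a small [s] increases [f]. *)
  pose b := Num.sqrt (w j 0); have b0 : 0 < b by rewrite sqrtr_gt0.
  have fv0 : 0 <= f v by apply: sumr_ge0 => i _; rewrite sqrtr_ge0.
  pose s := b / (b + f v); have bf0 : 0 < b + f v by rewrite ltr_wpDr.
  have s0 : 0 < s by rewrite divr_gt0.
  have s1 : s <= 1 by rewrite ler_pdivrMr// mul1r lerDl.
  have s21 : s ^+ 2 <= 1 by rewrite expr_le1// ltW.
  have := vmax w (s ^+ 2) Kw; rewrite sqr_ge0 s21 => /(_ isT).
  rewrite leNgt => /negP; apply.
  apply: (@lt_le_trans _ _ (s * b + (1 - s ^+ 2) * f v)).
    have sbf : s * (b + f v) = b by rewrite divfK// gt_eqF.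
    have -> : s * b + (1 - s ^+ 2) * f v =
              f v + (s * (s * b) + s * (b - s * (b + f v))) by ring.
    by rewrite sbf subrr mulr0 addr0 ltrDl mulr_gt0// mulr_gt0.
  rewrite /f !(bigD1 j (P := xpredT))//= vj0 sqrtr0 !add0r subr0.
  apply: lerD; first by rewrite ler_sqrt_of_sqr// exprMn sqr_sqrtr// ltW.
  rewrite mulr_sumr; apply: ler_sum => i _; apply: ler_sqrt_of_sqr.
  rewrite exprMn sqr_sqrtr//.
  have r0 := sqr_ge0 s; rewrite -subr_ge0 in s21.
  have := mulr_ge0 (mulr_ge0 r0 s21) (v0 i).
  have := mulr_ge0 r0 (ltW (w0 i)); lra.
pose a j := Num.sqrt (v j 0).
have a0 j : 0 < a j by rewrite sqrtr_gt0.
have a2 j : v j 0 = a j ^+ 2 by rewrite sqr_sqrtr.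
exists a; split=> // [S fS|u Ku].
  have /closure_id clE : closed [set v | f v <= S].
    apply: (@closed_comp _ _ f [set x | x <= S]) => [x _|]; first exact: cf.
    exact: closed_le.
  suff : closure [set v | f v <= S] v by rewrite -clE.
  by apply: closure_subset clv.
(* [P] is the slope at [v] of the sum of roots towards [u], and [Q] bounds the
   second-order loss; a positive slope would contradict maximality. *)
pose d j := u j 0 - v j 0.
pose P := \sum_j d j * (2 * a j)^-1.
pose Q := \sum_j d j ^+ 2 * (2 * a j ^+ 3)^-1.
have Q0 : 0 <= Q.
  apply: sumr_ge0 => j _; rewrite mulr_ge0 ?sqr_ge0// invr_ge0 mulr_ge0//.
  by rewrite exprn_ge0// ltW.
have PQ t : 0 <= t <= 1 -> t * P <= t ^+ 2 * Q.
  move=> t01; have := vmax u t Ku t01.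
  have : f v + t * P - t ^+ 2 * Q <= \sum_j Num.sqrt (v j 0 + t * d j).
    rewrite /f /P /Q !mulr_sumr -!(big_split, sumrB)/=.
    apply: ler_sum => j _; rewrite a2.
    have := @sqrt_ge_quadratic (a j) (t * d j) (a0 j).
    rewrite -a2 -/(a j) => H; apply: le_trans (H _).
      by rewrite exprMn !mulrA.
    have /andP[t0 t1] := t01; have /andP[u0 _] := K0M _ Ku j.
    have := v0 j; rewrite /d; nra.
  by rewrite /d; lra.
have P0 : P <= 0.
  rewrite leNgt; apply/negP => P0; have PQ0 : 0 < P + Q by rewrite ltr_wpDr.
  have t0 : 0 < P / (P + Q) by rewrite divr_gt0.
  have t1 : P / (P + Q) <= 1 by rewrite ler_pdivrMr// mul1r lerDl.
  have := PQ (P / (P + Q)); rewrite ltW//= => /(_ t1).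
  have : P / (P + Q) * (P + Q) = P by rewrite divfK// gt_eqF.
  set t := P / _ => tPQ tP.
  have : t * (t * Q) = t * (P - t * P) by rewrite -[in X in X - _]tPQ; ring.
  have : 0 < t * (t * P) by rewrite mulr_gt0// mulr_gt0.
  by lra.
have -> : \sum_j u j 0 / a j = \sum_j a j + 2 * P.
  rewrite mulr_sumr -big_split/=; apply: eq_bigr => j _.
  by rewrite /d a2; field; rewrite gt_eqF.
by rewrite gerDl; lra.
Qed.

End SqrtSum.

(** * Upper bound for a diagonal matrix *)

Section Diagonal.
Context {R : realType} {n : nat}.
Implicit Types (d x : 'rV[R]_n).

Lemma dotv_diag_mx d (x : 'cV[R]_n) :
  dotv x (diag_mx d *m x) = \sum_j d 0 j * x j 0 ^+ 2.
Proof.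
rewrite dotvE; apply: eq_bigr => j _.
by rewrite mul_diag_mx mxE expr2 mulrCA.
Qed.

Lemma posdef_diag_mx d : (forall j, 0 < d 0 j) -> posdefmx (diag_mx d).
Proof.
move=> d0; split=> [|x]; first exact: tr_diag_mx.
rewrite dotv_diag_mx => /eqP x0; rewrite lt_neqAle eq_sym.
have dx j : 0 <= d 0 j * x j 0 ^+ 2 by rewrite mulr_ge0 ?sqr_ge0 ?ltW.
rewrite sumr_ge0 // andbT; apply/eqP => sum0; apply: x0.
apply/matrixP => j c; rewrite ord1 [RHS]mxE; apply/eqP.
have /eqP := psumr_eq0P (fun i _ => dx i) sum0 (i := j) isT.
by rewrite mulf_eq0 gt_eqF//= sqrf_eq0.
Qed.

Lemma invmx_diag_mx d : (forall j, 0 < d 0 j) ->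
  invmx (diag_mx d) = diag_mx (\row_j (d 0 j)^-1).
Proof.
move=> d0; have uD := posdef_unitmx (posdef_diag_mx d0).
apply: (row_full_inj (A := diag_mx d)); first by rewrite row_full_unit.
rewrite mulmxV//; apply/matrixP => i j; rewrite mul_diag_mx !mxE.
have [->|_] := eqVneq i j; last by rewrite !mulr0n mulr0.
by rewrite !mulr1n mulfV// gt_eqF.
Qed.

(** Young's inequality, followed by [`|g i| <= 1] in the dual terms. The factor
    [Num.sqrt k%:R] in the matrix gives the [k] dual terms together the same
    order as the single primal one. *)
Lemma regret_diag_le k (a : 'I_n -> R) (F : 'I_k -> 'cV[R]_n -> R)
    (g : 'I_k -> 'cV[R]_n) (x : 'cV[R]_n) :
  let D := diag_mx (\row_j (Num.sqrt k%:R / a j)) in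
  (0 < k)%N -> (forall j, 0 < a j) -> (forall i, `|g i| <= 1) ->
  euclidean_run D F g ->
  regret D F g x <= 2^-1 * Num.sqrt k%:R *
    (\sum_j (a j)^-1 * x j 0 ^+ 2 + \sum_j a j).
Proof.
move=> D k0 a0 g1; rewrite {}/D; set s := Num.sqrt _; set D := diag_mx _ => run.
have s0 : 0 < s by rewrite sqrtr_gt0 ltr0n.
have s2 : s * s = k%:R by rewrite -expr2 sqr_sqrtr.
have d0 j : 0 < (\row_j (s / a j)) 0 j :> R by rewrite mxE divr_gt0.
have pD : posdefmx D := posdef_diag_mx d0.
apply: le_trans (regret_le_dotv x run) _.
rewrite regret_dotv ?posdef_inv_sym// mulrDr; apply: lerD.
  apply: le_trans (posdef_young _ _ pD) _.
  rewrite dotv_diag_mx -mulrA ler_pM2l ?invr_gt0// mulr_sumr.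
  by apply: ler_sum => j _; rewrite mxE -mulrA.
rewrite -mulrA ler_pM2l ?invr_gt0//.
rewrite (_ : s * _ = \sum_(i < k) \sum_j (a j / s)); last first.
  rewrite sumr_const card_ord -mulr_suml -[RHS]mulr_natl -s2.
  by field; rewrite gt_eqF.
apply: ler_sum => i _; rewrite invmx_diag_mx// dotv_diag_mx.
apply: ler_sum => j _; rewrite !mxE invf_div ger_pMr ?divr_gt0//.
by rewrite -real_normK ?num_real// expr_le1// (le_trans (le_normcV _ _)).
Qed.

End Diagonal.

(** * Adversarial linear losses *)

Section Adversary.
Context {R : realType} {n : nat}.
Implicit Types (A : 'M[R]_n) (u x y : 'cV[R]_n).

(** Alternating between [u] and [- u] collects the quadratic term of every round
    while the sum of the losses returns to zero; [m] further equal rounds bring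
    this sum to [- (t *: (A *m x))]. With [t = 1] this is the equality case of
    Young's inequality, and a smaller [t] needs fewer rounds. *)
Lemma regret_oscillate_drift A u x (t : R) (q m : nat) :
  posdefmx A -> `|u| <= 1 -> (0 < m)%N -> `|t *: (A *m x)| <= m%:R ->
  exists g : 'I_(q.*2 + m) -> 'cV[R]_n,
    (forall i, `|g i| <= 1) /\
    (t - t ^+ 2 / 2) * dotv x (A *m x) + q%:R * dotv u (invmx A *m u) <=
    regret A (fun i => dotv (g i)) g x.
Proof.
move=> pA u1 m0 tAm.
pose G := - (t *: (A *m x)).
pose f (i : nat) := if (i < q.*2)%N then (-1) ^+ i *: u else m%:R^-1 *: G.
have mr0 : 0 < m%:R :> R by rewrite ltr0n.
have osc : \sum_(0 <= i < q.*2) ((-1) ^+ i *: u : 'cV[R]_n) = 0.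
  elim: q {f} => [|q IH]; first by rewrite big_geq.
  rewrite doubleS !big_nat_recr//= IH add0r exprS -scalerDl mulN1r subrr.
  exact: scale0r.
have split_sum (V : nmodType) (h : 'cV[R]_n -> V) :
    \sum_(i < q.*2 + m) h (f i) =
    \sum_(0 <= i < q.*2) h ((-1) ^+ i *: u) + (h (m%:R^-1 *: G)) *+ m.
  rewrite -(big_mkord xpredT (fun i => h (f i))) (@big_cat_nat _ _ _ q.*2)//=.
    congr (_ + _); first by apply: eq_big_nat => i /andP[_ iq]; rewrite /f iq.
    rewrite (eq_big_nat _ _ (F2 := fun=> h (m%:R^-1 *: G))) => [|i /andP[qi _]].
      by rewrite sumr_const_nat addKn.
    by rewrite /f ltnNge qi.
  by rewrite leq_addr.
exists (fun i => f i); split=> [i|].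
  rewrite /f; case: ifP => _.
    by rewrite normrZ normrX normrN1 expr1n mul1r.
  by rewrite normrZ normfV normrN gtr0_norm// ler_pdivrMl// mulr1.
rewrite regret_dotv ?posdef_inv_sym//.
have -> : \sum_(i < q.*2 + m) f i = G.
  rewrite (split_sum _ id) osc add0r scalerMnl.
  by rewrite -[_ *+ m]mulr_natr mulVf ?scale1r// gt_eqF.
rewrite (split_sum _ (fun v => dotv v (invmx A *m v))).
rewrite (eq_bigr (fun=> dotv u (invmx A *m u))) => [|i _]; last first.
  by rewrite -scalemxAr dotvZl dotvZr mulrA -expr2 sqrr_sign mul1r.
rewrite sumr_const_nat subn0 -muln2 -[_ *+ (q * 2)]mulr_natl natrM.
have : 0 <= dotv (m%:R^-1 *: G) (invmx A *m (m%:R^-1 *: G)) *+ m.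
  by rewrite mulrn_wge0// posdef_inv_ge0.
set w := _ *+ m => w0; rewrite /G mulmxN -scalemxAr mulKmx ?posdef_unitmx//.
rewrite !(dotvNl, dotvNr, dotvZl, dotvZr) opprK (dotvC (A *m x)).
set z := dotv x _; set b := dotv u _; rewrite expr2; lra.
Qed.

Lemma mulmx_norm_le A x M : posdefmx A -> 0 <= M ->
  (forall j, `|x j 0| <= M) -> `|A *m x| <= n%:R * M * \tr A.
Proof.
move=> pA M0 xM; have tr0 : 0 <= \tr A.
  by apply: sumr_ge0 => j _; rewrite ltW// posdef_diag_gt0.
apply: normcV_le => [|i]; first by rewrite !mulr_ge0.
rewrite mxE; apply: le_trans (ler_norm_sum _ _ _) _.
apply: (@le_trans _ _ (\sum_(j < n) \tr A * M)).
  by apply: ler_sum => j _; rewrite normrM ler_pM// posdef_entry_le.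
by rewrite sumr_const card_ord -mulrA mulr_natl (mulrC M).
Qed.

(** Here the trace of the inverse enters: signs can be chosen so that it bounds
    the dual form from below, and it dominates the inverses of the diagonal. *)
Lemma posdef_inv_signs A : posdefmx A ->
  exists2 u : 'cV[R]_n, `|u| <= 1 &
    \sum_j (A j j)^-1 <= dotv u (invmx A *m u).
Proof.
move=> pA; have [s ls] := exists_signs_diag_le (const_mx 1) (posdef_inv_sym pA).
exists (flip_signs s (const_mx 1)).
  apply: normcV_le => // j.
  by rewrite !mxE mulr1 normrX normrN1 expr1n.
apply: le_trans ls; apply: ler_sum => j _.
by rewrite mxE expr1n mulr1 posdef_inv_diag.
Qed.

End Adversary.

(** The drift takes [m] rounds up to parity, the alternation being of even
    length. *)
Lemma even_rounds_split (k m : nat) : (m <= k)%N ->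
  exists q m', [/\ k = (q.*2 + m')%N, (m <= m')%N & (m' <= m.+1)%N].
Proof.
move=> mk; exists (k - m)./2, (m + odd (k - m))%N; split.
- by rewrite addnCA [(_.*2 + _)%N]addnC odd_double_half subnKC.
- exact: leq_addr.
- by rewrite -addn1 leq_add2l leq_b1.
Qed.

(** The constant [c] absorbs the drifting rounds. It must not depend on the
    matrix, whose size relative to [Num.sqrt k%:R] is arbitrary: [t] below
    truncates the drift so that its length is at most of order
    [Num.sqrt k%:R]. *)
Lemma exists_losses_regret_ge (R : realType) (n : nat) (X : set 'cV[R]_n) :
  compact X -> interior X !=set0 -> orthosymmetric X ->
  exists c : R, forall (k : nat) (A : 'M[R]_n), (0 < k)%N -> posdefmx A ->
    exists g : 'I_k -> 'cV[R]_n, (forall i, `|g i| <= 1) /\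
      exists2 x, X x & forall v, conv_hull (set_sqr X) v ->
        (Num.sqrt k%:R - c) * \sum_j Num.sqrt (v j 0) <=
        regret A (fun i => dotv (g i)) g x.
Proof.
move=> Xc Xint X_sym.
have [M M0 XM] := compact_coord_bounded Xc.
have [e e0 [y Xy ye]] := interior_coord_ge Xint.
(* [C] is chosen such that, once [t * \tr A = C * r], half of [t * q_A x] is at
   least [r * n%:R * M], and [n%:R * M] bounds every sum of roots. *)
pose C := 2 * n%:R * M / e ^+ 2.
have C0 : 0 <= C by rewrite divr_ge0 ?sqr_ge0// !mulr_ge0.
have Ce : C * e ^+ 2 = 2 * n%:R * M by rewrite divfK// sqrf_eq0 gt_eqF.
pose L := n%:R * M * C; have L0 : 0 <= L by rewrite mulr_ge0// mulr_ge0.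
exists (L + 2) => k A k0 pA.
have F0 (v : 'cV[R]_n) : 0 <= \sum_j Num.sqrt (v j 0) :> R.
  by apply: sumr_ge0 => j _; rewrite sqrtr_ge0.
pose r := Num.sqrt (k%:R : R); rewrite -/r.
have r1 : 1 <= r by apply: ler_sqrt_of_sqr; rewrite expr1n ler1n.
have r2 : r ^+ 2 = k%:R by rewrite sqr_sqrtr.
have Lr0 : 0 <= L * r by rewrite mulr_ge0// (le_trans ler01).
pose m := (Num.trunc (L * r)).+1.
have [mL Lm] : m%:R <= L * r + 1 /\ L * r <= m%:R.
  have /andP[] := truncn_itv Lr0; rewrite -/m => tr1 tr2.
  by split; [rewrite -natr1 lerD2r|exact: ltW].
have [km|mk] := ltnP k m.
  (* too few rounds for the drift: the left-hand side is not positive *)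
  exists (fun=> 0); split=> [i|]; first by rewrite normr0.
  exists y => // v hv; apply: (@le_trans _ _ 0).
    rewrite mulr_le0_ge0// subr_le0.
    have : k%:R <= L * r + 1 by rewrite (le_trans _ mL)// ler_nat ltnW.
    rewrite -r2 leNgt => h; rewrite leNgt; apply: contra h => h.
    rewrite expr2; nra.
  have dot0 z : dotv 0 z = 0 :> R
    by rewrite dotvE big1// => j _; rewrite mxE mul0r.
  by rewrite /regret big1// => i _; rewrite !dot0 subrr.
have [q [m' [kE mm' m'm]]] := even_rounds_split mk.
have m'Lr : L * r <= m'%:R by rewrite (le_trans Lm)// ler_nat.
have q2 : 2 * q%:R = r ^+ 2 - m'%:R.
  by rewrite r2 kE natrD -muln2 natrM; ring.
have m'le : m'%:R <= L * r + 2.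
  have : m'%:R <= m.+1%:R :> R by rewrite ler_nat.
  by rewrite -[m.+1%:R]natr1; lra.
have a0 j : 0 < A j j := posdef_diag_gt0 j pA.
have [x0 /set_mem Xx0 x0max] : exists2 c, c \in X & forall t, t \in X ->
    \sum_j A j j * t j 0 ^+ 2 <= \sum_j A j j * c j 0 ^+ 2.
  apply: compact_EVT_max => //; first by exists y.
  apply: continuous_subspaceT.
  apply: (@continuous_sum_coord R n (fun j z => A j j * z ^+ 2)) => j z.
  by apply: cvgM; [exact: cvg_cst|exact: exprn_continuous].
pose h := \sum_j A j j * x0 j 0 ^+ 2.
have h_hull : forall v, conv_hull (set_sqr X) v -> \sum_j A j j * v j 0 <= h.
  by apply: conv_hull_sqr_le => x Xx; exact/x0max/mem_set.
have eh : e ^+ 2 * \tr A <= h.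
  apply: le_trans (x0max y (mem_set Xy)); rewrite mulr_sumr.
  apply: ler_sum => j _; rewrite mulrC ler_pM2l//.
  by rewrite -[leRHS]real_normK ?num_real// ler_sqr ?nnegrE ?ye// ltW.
have [s hs] := exists_signs_diag_le x0 pA.1.
set x := flip_signs s x0 in hs; have Xx : X x := X_sym _ s Xx0.
have [u u1 ub] := posdef_inv_signs pA.
have tr0 : 0 <= \tr A by apply: sumr_ge0 => j _; rewrite ltW.
have [t [t01 tC tE]] : exists t : R, [/\ 0 <= t <= 1, t * \tr A <= C * r &
    t = 1 \/ t * \tr A = C * r].
  have [le|lt] := leP (\tr A) (C * r).
    by exists 1; rewrite ler01 lexx mul1r; split=> //; left.
  have Cr0 : 0 <= C * r by rewrite mulr_ge0// (le_trans ler01).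
  have trp := le_lt_trans Cr0 lt.
  exists (C * r / \tr A); rewrite divfK ?gt_eqF// lexx.
  rewrite divr_ge0//= ler_pdivrMr// mul1r ltW//; split=> //; by right.
have /andP[t0 t1] := t01.
have tAx : `|t *: (A *m x)| <= m'%:R.
  rewrite normrZ ger0_norm//; apply: le_trans m'Lr.
  have := mulmx_norm_le pA M0 (XM _ Xx) => /(ler_wpM2l t0) /le_trans; apply.
  by rewrite mulrCA /L -[leRHS]mulrA ler_wpM2l// mulr_ge0.
have [g [g1 gr]] : exists g : 'I_k -> 'cV[R]_n, (forall i, `|g i| <= 1) /\
    (t - t ^+ 2 / 2) * dotv x (A *m x) + q%:R * dotv u (invmx A *m u) <=
    regret A (fun i => dotv (g i)) g x.
  rewrite kE; apply: regret_oscillate_drift => //.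
  exact: leq_trans mm'.
exists g; split=> //; exists x => // v hv; apply: le_trans gr.
have tt : 0 <= t - t ^+ 2 / 2 by nra.
have h0 : 0 <= h.
  by apply: sumr_ge0 => j _; rewrite mulr_ge0 ?sqr_ge0// ltW.
apply: (@le_trans _ _ ((t - t ^+ 2 / 2) * h + q%:R * \sum_j (A j j)^-1));
    last first.
  by apply: lerD; rewrite ler_wpM2l.
have v0 j := conv_hull_sqr_coord XM hv j.
case: tE => [->|tE].
  (* the arithmetic-geometric mean inequality in each coordinate *)
  pose p := Num.sqrt (2 * q%:R : R).
  have p2 : p ^+ 2 = 2 * q%:R by rewrite sqr_sqrtr// mulr_ge0.
  apply: (@le_trans _ _ (p * \sum_j Num.sqrt (v j 0))).
    rewrite ler_wpM2r//; have [rL|/ltW rL] := leP (L + 2) r; last first.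
      by rewrite (@le_trans _ _ 0) ?sqrtr_ge0// subr_le0.
    apply: ler_sqrt_of_sqr; rewrite q2 !expr2.
    by nra.
  apply: (@le_trans _ _ (2^-1 * \sum_j A j j * v j 0 +
                         q%:R * \sum_j (A j j)^-1)); last first.
    by rewrite lerD2r; have := h_hull _ hv; rewrite expr1n; lra.
  rewrite !mulr_sumr -big_split/=; apply: ler_sum => j _.
  have /andP[vj0 _] := v0 j.
  rewrite -[in leRHS](sqr_sqrtr vj0); set w := Num.sqrt _.
  rewrite (_ : q%:R = p ^+ 2 / 2); last by rewrite p2; field.
  rewrite -subr_ge0 (_ : _ - _ = (A j j * w - p) ^+ 2 * (2 * A j j)^-1).
    by rewrite mulr_ge0 ?sqr_ge0// invr_ge0 mulr_ge0// ltW.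
  by field; rewrite gt_eqF.
have q0 : 0 <= q%:R * \sum_j (A j j)^-1.
  by rewrite mulr_ge0// sumr_ge0// => j _; rewrite invr_ge0 ltW.
have FM : \sum_j Num.sqrt (v j 0) <= n%:R * M.
  apply: (@le_trans _ _ (\sum_(j < n) M)); last first.
    by rewrite sumr_const card_ord mulr_natl.
  apply: ler_sum => j _; rewrite -[leRHS](ger0_norm M0) -sqrtr_sqr.
  by rewrite ler_wsqrtr//; have /andP[] := v0 j.
apply: (@le_trans _ _ (r * (n%:R * M))).
  apply: (@le_trans _ _ (r * \sum_j Num.sqrt (v j 0))).
    by rewrite ler_wpM2r//; lra.
  by rewrite ler_wpM2l// (le_trans ler01).
have : t / 2 * (e ^+ 2 * \tr A) = r * (n%:R * M).
  have -> : t / 2 * (e ^+ 2 * \tr A) = e ^+ 2 * (t * \tr A) / 2 by field.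
  have -> : e ^+ 2 * (t * \tr A) = r * (C * e ^+ 2) by rewrite tE; ring.
  by rewrite Ce; field.
have : t / 2 * (e ^+ 2 * \tr A) <= t / 2 * h.
  by rewrite ler_wpM2l// divr_ge0.
have : t / 2 * h <= (t - t ^+ 2 / 2) * h.
  by rewrite ler_wpM2r// expr2; nra.
lra.
Qed.

(** * Passing to the limit *)

Lemma cvg_inv_sqrt (R : realType) :
  (Num.sqrt (k%:R : R))^-1 @[k --> \oo] --> (0 : R).
Proof.
have inv0 : (k%:R : R)^-1 @[k --> \oo] --> (0 : R).
  apply/gtr0_cvgV0; last exact: cvgr_idn.
  by exists 1%N => // k /= k0; rewrite ltr0n.
rewrite -(sqrtr0 R); under eq_cvg do rewrite -sqrtrV//.
by apply: continuous_cvg => //; exact: sqrt_continuous.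
Qed.

Lemma le_limn_einf (R : realType) (u w : (\bar R)^nat) (l : \bar R) :
  (forall k, (0 < k)%N -> (w k <= u k)%E) -> w @ \oo --> l ->
  (l <= limn_einf u)%E.
Proof.
move=> wu wl; rewrite limn_einf_lim -(cvg_lim _ (cvg_einfs wl))//.
apply: lee_lim; [exact: is_cvg_einfs|exact: is_cvg_einfs|].
exists 1%N => // N /= N0; apply: le_ereal_inf_tmp => _ [k /= Nk <-].
apply: le_trans (wu k (leq_trans N0 Nk)).
by apply: ereal_inf_lbound; exists k.
Qed.

Theorem corollary10 (R : realType) (n : nat) (X : set 'cV[R]_n)
    (X_body : convex_body X) (X_sym : orthosymmetric X) :
  (forall A : nat -> 'M[R]_n,
     (forall k, (0 < k)%N -> posdefmx (A k)) ->
     exists g : forall k : nat, 'I_k -> 'cV[R]_n,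
       [/\ forall (k : nat) (i : 'I_k), `|g k i| <= 1,
           forall k : nat, euclidean_run (A k) (fun i => dotv (g k i)) (g k)
         & (ereal_sup [set (l1norm x)%:E | x in QHull X] <=
            limn_einf (fun k : nat =>
              ((Num.sqrt k%:R)^-1)%:E *
              ereal_sup [set (regret (A k) (fun i => dotv (g k i)) (g k) x)%:E
                        | x in X]))%E]) /\
  (forall k : nat, (0 < k)%N ->
     exists D : 'M[R]_n,
       [/\ is_diag_mx D, posdefmx D
         & forall F : 'I_k -> 'cV[R]_n -> R,
             (forall i, convex_function setT (F i)) ->
             (forall i x h, subgradient (F i) x h -> `|h| <= 1) ->
             forall g : 'I_k -> 'cV[R]_n, euclidean_run D F g ->
             (ereal_sup [set (regret D F g x)%:E | x in X] <=
              (Num.sqrt k%:R)%:E *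
              ereal_sup [set (l1norm x)%:E | x in QHull X])%E]).
Proof.
have [Xc _ Xint] := X_body; split.
  move=> A pA; have [c hc] := exists_losses_regret_ge Xc Xint X_sym.
  have game k : exists g : 'I_k -> 'cV[R]_n, (forall i, `|g i| <= 1) /\
      ((0 < k)%N -> exists2 x, X x & forall v, conv_hull (set_sqr X) v ->
        (Num.sqrt k%:R - c) * \sum_j Num.sqrt (v j 0) <=
        regret (A k) (fun i => dotv (g i)) g x).
    have [->|k0] := posnP k.
      by exists (fun=> 0); split=> // i; rewrite normr0.
    by have [g [g1 gx]] := hc k (A k) k0 (pA k k0); exists g.
  pose g k := sval (cid (game k)); exists g.
  split=> [k i|k|]; first by have [g1 _] := svalP (cid (game k)); exact: g1.
    exact/euclidean_run_linear.
  apply: ge_ereal_sup => _ [z Qz <-].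
  pose w k := (l1norm z * (1 - c * (Num.sqrt (k%:R : R))^-1))%:E.
  apply: (@le_limn_einf _ _ w) => [k k0|]; last first.
    apply: cvg_EFin; first exact: nearW.
    rewrite -[X in _ --> X]mulr1; apply: cvgM; first exact: cvg_cst.
    rewrite -[X in _ --> X]subr0; apply: cvgB; first exact: cvg_cst.
    rewrite -[X in _ --> X](mulr0 c); apply: cvgM; first exact: cvg_cst.
    exact: cvg_inv_sqrt.
  have [_ /(_ k0)[x Xx gx]] := svalP (cid (game k)).
  have s0 : 0 < Num.sqrt (k%:R : R) by rewrite sqrtr_gt0 ltr0n.
  apply: (@le_trans _ _ ((Num.sqrt k%:R)^-1%:E *
      (regret (A k) (fun i => dotv (g k i)) (g k) x)%:E)%E).
    rewrite -EFinM lee_fin ler_pdivlMl//.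
    have [v hv vz] : [set \sum_j Num.sqrt (v j 0) | v in
        conv_hull (set_sqr X)] (l1norm z) by rewrite -l1norm_QHull; exists z.
    have -> : Num.sqrt k%:R * (l1norm z * (1 - c * (Num.sqrt k%:R)^-1)) =
              (Num.sqrt k%:R - c) * l1norm z by field; rewrite gt_eqF.
    by rewrite -vz; exact: gx.
  apply: lee_wpmul2l; first by rewrite lee_fin invr_ge0 ltW.
  by apply: ereal_sup_ubound; exists x.
move=> k k0.
have [M M0 XM] := compact_coord_bounded Xc.
have [e e0 [y Xy ye]] := interior_coord_ge Xint.
have hy : conv_hull (set_sqr X) (map_mx (fun t => t ^+ 2) y).
  by apply: sub_conv_hull; exists y.
have hy0 j : 0 < (map_mx (fun t => t ^+ 2) y) j 0.
  by rewrite mxE -real_normK ?num_real// exprn_gt0// (lt_le_trans e0).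
have [a [a0 aS aK]] := sqrt_sum_supporting (@conv_hull_convex _ _ _)
  (conv_hull_sqr_coord XM) hy hy0.
exists (diag_mx (\row_j (Num.sqrt k%:R / a j))); split.
- exact: diag_mx_is_diag.
- by apply: posdef_diag_mx => j; rewrite mxE divr_gt0// sqrtr_gt0 ltr0n.
move=> F _ F1 g run; apply: ge_ereal_sup => _ [x Xx <-].
apply: (@le_trans _ _ ((Num.sqrt k%:R)%:E * (\sum_j a j)%:E)%E).
  rewrite -EFinM lee_fin.
  apply: le_trans (regret_diag_le x k0 a0 (fun i => F1 _ _ _ (run i)) run) _.
  rewrite -mulrA mulrCA ler_wpM2l ?sqrtr_ge0//.
  have : \sum_j (a j)^-1 * x j 0 ^+ 2 <= \sum_j a j.
    apply: le_trans (aK _ (sub_conv_hull (imageP _ Xx))).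
    by apply: ler_sum => j _; rewrite mxE mulrC.
  by lra.
apply: lee_wpmul2l; first by rewrite lee_fin sqrtr_ge0.
set S := ereal_sup _.
have hS v : conv_hull (set_sqr X) v -> ((\sum_j Num.sqrt (v j 0))%:E <= S)%E.
  move=> hv; have [z Qz <-] : [set l1norm x | x in QHull X]
      (\sum_j Num.sqrt (v j 0)) by rewrite l1norm_QHull; exists v.
  by apply: ereal_sup_ubound; exists z.
case: S hS => [s hS|_|/(_ _ hy)]; [|exact: leey|by rewrite leeNy_eq].
by rewrite lee_fin; apply: aS => v /hS; rewrite lee_fin.
Qed.
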